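(* For every integer $n>2$, the rectangle $R(3,n)$ has no faultfree tromino tiling.
   Context: $R(m,n)$ denotes the rectangle with $m$ rows and $n$ columns of unit squares. A tromino is an L-shaped tromino, i.e. a $2\times 2$ block of unit squares with one unit square removed, in any of its four orientations. A tromino tiling of $R(m,n)$ is a partition of its unit squares into trominoes. A fault line of a tiling is a horizontal or vertical line that cuts the rectangle into two (nonempty) pieces and does not pass through any of the tiles. A tiling is faultfree if it has no fault line. *)

(* Defs.v *)
From mathcomp Require Import all_boot.

Set Implicit Arguments.
Unset Strict Implicit.
Unset Printing Implicit Defensive.

(* R(m, n) is represented by its set of unit squares,
   indexed by (row, column). *)
Definition cell (m n : nat) : finType := ('I_m * 'I_n)%type.

(* [a] is the square of least row and column; the block is truncated when [a]
   lies in the last row or column, which [tromino] excludes. *)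
Definition block22 m n (a : cell m n) : {set cell m n} :=
  [set c : cell m n | (a.1 <= c.1 <= a.1.+1) && (a.2 <= c.2 <= a.2.+1)].

Definition tromino m n (t : {set cell m n}) : bool :=
  [exists a : cell m n, exists c : cell m n,
    [&& a.1.+1 < m, a.2.+1 < n, c \in block22 a & t == block22 a :\ c]].

Definition tromino_tiling m n (P : {set {set cell m n}}) : bool :=
  partition P [set: cell m n] && [forall t in P, tromino t].

(* A line that avoids the interiors of all tiles is necessarily a grid line.
   The horizontal grid line [k] separates rows [0 .. k-1] from rows [k .. m-1];
   it passes through a tile when the tile has a square on each side. *)
Definition hcrosses m n (k : nat) (t : {set cell m n}) : bool :=
  [exists c in t, c.1 < k] && [exists c in t, k <= c.1].

Definition vcrosses m n (k : nat) (t : {set cell m n}) : bool :=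
  [exists c in t, c.2 < k] && [exists c in t, k <= c.2].

Definition hfault m n (P : {set {set cell m n}}) (k : nat) : bool :=
  (0 < k < m) && [forall t in P, ~~ hcrosses k t].

Definition vfault m n (P : {set {set cell m n}}) (k : nat) : bool :=
  (0 < k < n) && [forall t in P, ~~ vcrosses k t].

Definition faultfree m n (P : {set {set cell m n}}) : Prop :=
  ~ (exists k : nat, hfault P k \/ vfault P k).

(* Main.v *)
Require Import Defs.
From mathcomp Require Import all_boot.
From mathcomp Require Import zify.

(** The first two columns of a [3 x n] rectangle are always tiled separately,
    so the vertical line [2] is a fault line as soon as [2 < n].

    Every tile fits in two consecutive rows and two consecutive columns
    ([tromino_rows], [tromino_cols]).  Hence the two end squares of the first
    column, being two rows apart, lie in different tiles, and both tiles stay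
    within the first two columns.  Two disjoint trominoes have [6] squares
    ([card_tromino]), and [6] is exactly the number of squares in the first two
    columns ([card_left_columns]), so these two tiles fill them completely.  A
    tile crossing the line [2] would meet, hence be, one of the two, yet neither
    of them reaches the third column. *)

Lemma card_ord_pair n (i : 'I_n) :
  i.+1 < n -> #|[set j : 'I_n | i <= j <= i.+1]| = 2.
Proof.
move=> lt_i1n.
have -> : [set j : 'I_n | i <= j <= i.+1] = [set i; Ordinal lt_i1n].
  by apply/setP=> j; rewrite !inE -!val_eqE /=; lia.
by rewrite cards2 -val_eqE /= neq_ltn ltnSn.
Qed.

Lemma card_tromino {m n} {t : {set cell m n}} : tromino t -> #|t| = 3.
Proof.
case/existsP=> a /existsP[c /and4P[lt_m lt_n c_in /eqP->]].
have card_block : #|block22 a| = 4.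
  have -> : block22 a = setX [set i : 'I_m | a.1 <= i <= a.1.+1]
                             [set j : 'I_n | a.2 <= j <= a.2.+1].
    by apply/setP=> d; rewrite !inE.
  by rewrite cardsX !card_ord_pair.
by move: card_block; rewrite (cardsD1 c) c_in => -[].
Qed.

Lemma tromino_rows {m n} {t : {set cell m n}} {c d} :
  tromino t -> c \in t -> d \in t -> c.1 <= d.1.+1.
Proof.
case/existsP=> a /existsP[e /and4P[_ _ _ /eqP->]].
by rewrite !inE => ? ?; lia.
Qed.

Lemma tromino_cols {m n} {t : {set cell m n}} {c d} :
  tromino t -> c \in t -> d \in t -> c.2 <= d.2.+1.
Proof.
case/existsP=> a /existsP[e /and4P[_ _ _ /eqP->]].
by rewrite !inE => ? ?; lia.
Qed.

Lemma card_left_columns m n k :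
  k <= n -> #|[set c : cell m n | c.2 < k]| = m * k.
Proof.
move=> le_kn.
have -> : [set c : cell m n | c.2 < k]
          = setX [set: 'I_m] (widen_ord le_kn @: [set: 'I_k]).
  apply/setP=> c; rewrite !inE /=; apply/idP/imsetP => [lt_ck | [j _ ->]] //=.
  by exists (Ordinal lt_ck); rewrite ?inE //; apply: val_inj.
rewrite cardsX cardsT card_ord card_imset ?cardsT ?card_ord //.
by move=> i j /(congr1 val) /= eq_ij; apply: val_inj.
Qed.

(** Height [3] enters twice: it forces the corners of the first column into
    different tiles, and it makes the area [3 * 2] of two columns equal to that
    of two trominoes. *)
Lemma tromino_tiling_vfault2 n (P : {set {set cell 3 n}}) :
  2 < n -> tromino_tiling P -> vfault P 2.
Proof.
move=> lt2n /andP[/and3P[/eqP coverP disjP _] /forall_inP tromP].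
have inP c : exists2 t, t \in P & c \in t.
  have: c \in cover P by rewrite coverP inE.
  by case/bigcupP=> t; exists t.
have lt0n : 0 < n by lia.
have [s sP s_top] := inP (ord0, Ordinal lt0n).
have [t tP t_bot] := inP (ord_max, Ordinal lt0n).
have st : s != t.
  apply: contraTneq t_bot => <-; apply/negP => s_bot.
  by have := tromino_rows (tromP s sP) s_bot s_top.
have disj_st : [disjoint s & t] by exact: (trivIsetP disjP).
have sub_left : s :|: t \subset [set c : cell 3 n | c.2 < 2].
  apply/subsetP=> c; rewrite !inE => /orP[c_in | c_in].
    exact: (tromino_cols (tromP s sP) c_in s_top).
  exact: (tromino_cols (tromP t tP) c_in t_bot).
have fill_left : s :|: t = [set c : cell 3 n | c.2 < 2].
  apply/eqP; rewrite eqEcard sub_left card_left_columns ?(ltnW lt2n) //.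
  move: disj_st; rewrite -leq_card_setU => /eqP->.
  by rewrite !card_tromino ?tromP.
rewrite /vfault lt2n; apply/forall_inP=> u uP.
apply/negP=> /andP[/exists_inP[c c_u c_left] /exists_inP[d d_u d_right]].
(* The tile [u] crosses the line; its square [c] left of it is in [s] or [t]. *)
have u_st : (u == s) || (u == t).
  have : c \in s :|: t by rewrite fill_left inE.
  rewrite inE => /orP[c_in | c_in]; apply/orP; [left | right];
    apply/eqP; rewrite -(def_pblock disjP uP c_u); exact: def_pblock.
have : d \in s :|: t by rewrite inE; case/orP: u_st => /eqP<-; rewrite d_u ?orbT.
by rewrite fill_left inE ltnNge d_right.
Qed.

Theorem lemma1 (n : nat) (hn : 2 < n) :
  ~ (exists P : {set {set cell 3 n}}, tromino_tiling P /\ faultfree P).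
Proof.
case=> P [tilP]; apply; exists 2; right.
exact: tromino_tiling_vfault2.
Qed.
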